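(* Let $[x_1,x_2,\dots,x_k]$ be a topdrop-valid necklace in $S_n$. If $n$ is even, then the number of indices $i$ with $x_i\equiv1$ or $2\pmod 4$ is even. If $n$ is odd, then the number of indices $i$ with $x_i\equiv2$ or $3\pmod 4$ is even.
   Context: Permutations are in one-line notation $\pi=\pi_1\cdots\pi_n$. The topdrop map $T:S_n\to S_n$ is $T(\pi_1\cdots\pi_n)=\pi_{\pi_1+1}\cdots\pi_n\,\pi_{\pi_1}\pi_{\pi_1-1}\cdots\pi_1$ (first $\pi_1$ entries removed, reversed, appended at the end); it is a bijection. The topdrop-necklace of $\pi$ is the cyclic sequence $[\pi_1,T(\pi)_1,\dots,T^{s-1}(\pi)_1]$, where $s\ge1$ is minimal with $T^s(\pi)=\pi$, considered up to cyclic rotation. A necklace is topdrop-valid in $S_n$ if it is the topdrop-necklace of some $\pi\in S_n$. *)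

(* Defs.v *)
From mathcomp Require Import all_boot all_fingroup.
From mathcomp Require Import zify.

Set Implicit Arguments.
Unset Strict Implicit.
Unset Printing Implicit Defensive.

(* 'S_n permutes {0, ..., n - 1}; the one-line notation is shifted so that its
   letters are 1, ..., n. *)
Definition one_line (n : nat) (p : 'S_n) : seq nat :=
  [seq (p i).+1 | i <- enum 'I_n].

Definition first_entry (n : nat) (p : 'S_n) : nat := head 0 (one_line p).

Lemma size_one_line n (p : 'S_n) : size (one_line p) = n.
Proof. by rewrite size_map size_enum_ord. Qed.

Lemma nth_one_line n (p : 'S_n) (i : 'I_n) : nth 0 (one_line p) i = (p i).+1.
Proof. by rewrite (nth_map i) ?size_enum_ord // nth_ord_enum. Qed.

Lemma one_line_inj n : injective (@one_line n).
Proof.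
move=> p q epq; apply/permP => i; apply/val_inj/succn_inj.
by rewrite -!nth_one_line epq.
Qed.

Lemma first_entry_bounds n (p : 'S_n) : 0 < n -> 0 < first_entry p <= n.
Proof.
by move=> n_gt0; rewrite /first_entry -nth0 (nth_one_line p (Ordinal n_gt0)) /=.
Qed.

(* Position, counted from 0, in p of the i-th letter of the topdrop image of p,
   where a is the first letter of p: the letters at positions a, ..., n - 1 come
   first, then those at positions a - 1, ..., 0 (see one_line_topdrop). *)
Definition topdrop_pos (n a : nat) (i : 'I_n) : 'I_n :=
  if i + a < n then insubd i (i + a) else rev_ord i.

Lemma val_topdrop_pos n a (i : 'I_n) :
  topdrop_pos a i = (if i + a < n then i + a else n - i.+1) :> nat.
Proof. by rewrite /topdrop_pos; case: ifP => // h; rewrite val_insubd h. Qed.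

Lemma topdrop_pos_inj n a : injective (@topdrop_pos n a).
Proof.
move=> i j /(congr1 val); rewrite /= !val_topdrop_pos => e; apply: val_inj => /=.
have := ltn_ord i; have := ltn_ord j; move: e.
by case: ifP; case: ifP; lia.
Qed.

Definition topdrop (n : nat) (p : 'S_n) : 'S_n :=
  (perm (@topdrop_pos_inj n (first_entry p)) * p)%g.

Lemma topdropE n (p : 'S_n) i : topdrop p i = p (topdrop_pos (first_entry p) i).
Proof. by rewrite permM permE. Qed.

Lemma one_line_topdrop n (p : 'S_n) :
  one_line (topdrop p) =
  drop (first_entry p) (one_line p) ++ rev (take (first_entry p) (one_line p)).
Proof.
have [n0 | n_gt0] := posnP n.
  have nil0 (q : 'S_n) : one_line q = [::].
    by apply/size0nil; rewrite size_one_line.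
  by rewrite !nil0.
have /andP[a_gt0 le_an] := first_entry_bounds p n_gt0.
set a := first_entry p in a_gt0 le_an *.
have szt : size (take a (one_line p)) = a.
  by rewrite size_takel // size_one_line.
apply: (@eq_from_nth _ 0) => [|i].
  by rewrite size_cat size_rev szt size_drop !size_one_line; lia.
rewrite size_one_line => lt_in.
rewrite (nth_one_line _ (Ordinal lt_in)) topdropE -nth_one_line val_topdrop_pos.
rewrite nth_cat size_drop size_one_line -/a /=.
case: ifP => h.
  by rewrite ifT ?nth_drop 1?addnC //; lia.
rewrite ifF; last by lia.
rewrite nth_rev szt; last by lia.
by rewrite nth_take; [congr nth; lia | lia].
Qed.

Lemma topdrop_inj n : injective (@topdrop n).
Proof.
move=> p q epq.
have [n0 | n_gt0] := posnP n.
  by apply/permP => i; have := ltn_ord i; rewrite {2}n0.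
have last_topdrop (r : 'S_n) : last 0 (one_line (topdrop r)) = first_entry r.
  have /andP[a_gt0 _] := first_entry_bounds r n_gt0.
  rewrite one_line_topdrop last_cat; move: a_gt0; rewrite /first_entry.
  case: (one_line r) => [|x s] //=; case: x => // x _ /=.
  by rewrite rev_cons last_rcons.
have ea : first_entry p = first_entry q by rewrite -!last_topdrop epq.
by move: epq; rewrite /topdrop ea => /mulgI.
Qed.

Definition is_topdrop_period (n : nat) (p : 'S_n) (s : nat) : Prop :=
  [/\ 0 < s, iter s (@topdrop n) p = p
    & forall t, 0 < t < s -> iter t (@topdrop n) p <> p].

Lemma is_topdrop_period_order n (p : 'S_n) :
  is_topdrop_period p (fingraph.order (@topdrop n) p).
Proof.
split=> [||t /andP[t_gt0 lt_t] e]; first exact: fingraph.order_gt0.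
  exact/iter_order/topdrop_inj.
by have := findex_iter lt_t; rewrite e findex0; lia.
Qed.

(* The word x is a representative, starting anywhere, of the topdrop-necklace
   of p. *)
Definition is_topdrop_necklace (n : nat) (p : 'S_n) (x : seq nat) : Prop :=
  exists s r : nat, is_topdrop_period p s /\
    x = rot r (mkseq (fun i => first_entry (iter i (@topdrop n) p)) s).

Definition topdrop_valid (n : nat) (x : seq nat) : Prop :=
  exists p : 'S_n, is_topdrop_necklace p x.

(* Main.v *)
Require Import Defs.
From mathcomp Require Import all_boot all_fingroup.
From mathcomp Require Import zify.

(** One step T composes a permutation with the position permutation
    [topdrop_pos a], a its first letter, whose signature is that of
    a (n - a) + a (a - 1) / 2 inversions. Around a necklace the permutation
    returns to itself, so an even number of steps are odd; the stated residue
    classes mod 4 are exactly the letters a whose step is odd. *)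

Lemma odd_bin2 m : odd 'C(m, 2) = odd m./2.
Proof.
elim: m => // m IHm.
by rewrite binS bin1 oddD IHm /= uphalf_half oddD oddb addbC.
Qed.

(** Since a * a and a agree mod 2, a (n - a) + 'C(a, 2) has the parity of a n + 'C(a.+1, 2), a form
    without subtraction. *)
Lemma odd_perm_topdrop_pos n a :
  a <= n -> odd_perm (perm (@topdrop_pos_inj n a)) = odd (a * n + 'C(a.+1, 2)).
Proof.
elim: a n => [|a IHa] n le_an.
  rewrite (_ : perm _ = 1%g) ?odd_perm1 ?mul0n //; apply/permP => i.
  by apply: val_inj; rewrite permE perm1 /= val_topdrop_pos addn0 ltn_ord.
case: n le_an => // n le_an.
(* Dropping the last position, which is sent to position 0, lowers both a and
   n by one. *)
have -> : perm (@topdrop_pos_inj n.+1 a.+1) =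
          lift_perm ord_max ord0 (perm (@topdrop_pos_inj n a)).
  apply/permP => i; rewrite permE; apply: val_inj.
  case: (unliftP ord_max i) => [j ->|->].
    rewrite lift_perm_lift permE -[LHS]/(nat_of_ord _).
    rewrite -[RHS]/(nat_of_ord _) lift0.
    rewrite !val_topdrop_pos lift_max addnS ltnS; have /= := ltn_ord j.
    by case: ifP => // _; lia.
  by rewrite lift_perm_id /= val_topdrop_pos ifF /=; lia.
(* Moving position n to 0 crosses n others, so the lift contributes the parity of n. *)
rewrite odd_lift_perm IHa // [in RHS]binS bin1; move: 'C(a.+1, 2) => c.
rewrite !(oddD, oddM, oddS) /=.
by case: (odd a); case: (odd n); case: (odd c).
Qed.

Lemma odd_perm_iter_topdrop n (p : 'S_n) s : 0 < n ->
  odd_perm (iter s (@topdrop n) p) =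
  odd (count (fun a => odd (a * n + 'C(a.+1, 2)))
         (mkseq (fun i => first_entry (iter i (@topdrop n) p)) s)) (+) odd_perm p.
Proof.
move=> n_gt0; elim: s => // s IHs.
have /andP[_ le_an] := first_entry_bounds (iter s (@topdrop n) p) n_gt0.
rewrite iterS odd_permM odd_perm_topdrop_pos // IHs mkseqS -cats1 count_cat /= addn0.
by rewrite [in RHS]oddD oddb addbA [X in X (+) _]addbC.
Qed.

Theorem theorem5p2 (n : nat) (hn : 0 < n) (x : seq nat)
    (hx : topdrop_valid n x) :
  (~~ odd n ->
     ~~ odd (count (fun y => (y == 1 %[mod 4]) || (y == 2 %[mod 4])) x)) /\
  (odd n ->
     ~~ odd (count (fun y => (y == 2 %[mod 4]) || (y == 3 %[mod 4])) x)).
Proof.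
have [p [s [r [[_ period_s _] ->]]]] := hx.
set w := mkseq _ s.
have even_w : ~~ odd (count (fun a => odd (a * n + 'C(a.+1, 2))) (rot r w)).
  rewrite (seq.permP (permEl (perm_rot r w))); apply/negbT.
  have := odd_perm_iter_topdrop n p s hn; rewrite period_s -/w.
  by case: (odd _); case: (odd_perm p).
(* For n even, (a.+1)./2 is odd iff a is 1 or 2 mod 4; for n odd, a + (a.+1)./2 is odd iff a is 2 or
   3 mod 4. *)
split=> n_parity; apply: contraNN even_w; congr (is_true (odd _));
  apply: eq_count => a /=; rewrite oddD oddM odd_bin2.
  by rewrite (negbTE n_parity) andbF /=; lia.
by rewrite n_parity andbT /=; lia.
Qed.
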